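(* (i) The map $\Phi(S^-,S)=(S,S^+)$ is given by the following equivalent equations (for all $i$): $$\frac1{S_i^+-S_i}+\frac1{S_i^--S_i}=\frac1{S_{i+1}-S_i}+\frac1{S_{i-1}-S_i},$$ $$\frac{(S_i^+-S_{i+1})(S_i-S_i^-)(S_i-S_{i-1})}{(S_i^+-S_i)(S_{i+1}-S_i)(S_i^--S_{i-1})}=-1,$$ $$\frac{(S_i^+-S_{i-1})(S_i-S_i^-)(S_{i+1}-S_i)}{(S_i^+-S_i)(S_i-S_{i-1})(S_i^--S_{i+1})}=-1.$$ (ii) The map induced by $\Phi$ on the moduli space $\mathcal S_n/PGL(2,\mathbf R)$, written in the coordinates $(\mathbf x,\mathbf y)$, is the map $T_2$.
   Context: A twisted $n$-gon in $\mathbf{RP}^1$ is a sequence $(S_i)_{i\in\mathbf Z}$ of points with $S_{i+n}=M(S_i)$ for all $i$ and a fixed projective transformation $M$ (the monodromy). $\mathcal S_n$ is the space of pairs $(S^-,S)$ of twisted $n$-gons in $\mathbf{RP}^1$ with the same monodromy; $PGL(2,\mathbf R)$ acts on it diagonally. Points are assumed generic (so that all expressions are defined) and are written as numbers in an affine coordinate on $\mathbf{RP}^1$. The leapfrog map $\Phi:\mathcal S_n\to\mathcal S_n$ is $\Phi(S^-,S)=(S,S^+)$, where $S_i^+$ is the image of $S_i^-$ under the unique projective involution of $\mathbf{RP}^1$ that fixes $S_i$ and interchanges $S_{i-1}$ and $S_{i+1}$. It commutes with $PGL(2,\mathbf R)$. The coordinates on $\mathcal S_n/PGL(2,\mathbf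 R)$ are the $n$-periodic sequences $$x_i=\frac{(S_{i+1}-S^-_{i+2})(S^-_i-S^-_{i+1})}{(S^-_i-S_{i+1})(S^-_{i+1}-S^-_{i+2})},\qquad y_i=\frac{(S^-_{i+1}-S_{i+1})(S^-_{i+2}-S_{i+2})(S^-_i-S^-_{i+1})}{(S^-_{i+1}-S_{i+2})(S^-_i-S_{i+1})(S^-_{i+1}-S^-_{i+2})}.$$ The map $T_2$ is (indices mod $n$) $$x_i^*=x_{i-1}\frac{x_i+y_i}{x_{i-1}+y_{i-1}},\qquad y_i^*=y_i\frac{x_{i+1}+y_{i+1}}{x_i+y_i}.$$ *)

(* Defs.v *)
From HB Require Import structures.
From mathcomp Require Import all_boot all_order all_algebra generic_quotient.
From mathcomp Require Import boolp classical_sets reals.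

Set Implicit Arguments.
Unset Strict Implicit.
Unset Printing Implicit Defensive.

Import Order.TTheory GRing.Theory Num.Theory.
Local Open Scope ring_scope.
Local Open Scope quotient_scope.

(* RP^1 in an affine coordinate: [Some z] is the point with coordinate z and
   [None] is the point at infinity. *)
Definition RP1 (R : realType) : Type := option R.

Section ProjectiveLine.
Variable R : realType.
Implicit Types (P Q a b c : RP1 R) (f g : RP1 R -> RP1 R) (v : 'cV[R]_2).

Definition homog P : 'cV[R]_2 :=
  if P is Some z then \col_i (if i == 0 then z else 1)
  else \col_i (if i == 0 then 1 else 0).

Definition dehomog v : RP1 R :=
  if v 1 0 == 0 then None else Some (v 0 0 / v 1 0).

Definition mobius (A : 'M[R]_2) P : RP1 R := dehomog (A *m homog P).

(* The transformations in PGL(2, R), seen as maps of RP^1. *)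
Definition projective f := exists2 A : 'M[R]_2, A \in unitmx & f = mobius A.

(* Difference of affine coordinates. When a point is at infinity, this is the
   determinant of the lifts [homog P] and [homog Q], as for finite points; so
   the expressions below that have degree 0 in each point take their usual
   cross-ratio values there. *)
Definition pdiff P Q : R :=
  match P, Q with
  | Some z, Some w => z - w
  | None, Some _ => 1
  | Some _, None => - 1
  | None, None => 0
  end.

(* An involution has order exactly two, hence [f <> id]; this matters only for
   a = c, where the identity also fixes b and swaps a and c. *)
Definition swapping_involution a b c f :=
  [/\ projective f, involutive f, f <> id, f b = b & f a = c /\ f c = a].

(* The unique involution above; the identity when it is not unique or does
   not exist, that is, when b = a or b = c. *)
Definition swap_involution a b c : RP1 R -> RP1 R :=
  xget (id : RP1 R -> RP1 R) [set f | swapping_involution a b c f /\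
                   forall g, swapping_involution a b c g -> g = f]%classic.

Lemma homog_neq0 P : homog P != 0.
Proof.
apply/eqP => /matrixP h; case: P h => [z|] h.
- by have := h 1 0; rewrite !mxE /= => /eqP; rewrite oner_eq0.
- by have := h 0 0; rewrite !mxE /= => /eqP; rewrite oner_eq0.
Qed.

Lemma dehomogK P : dehomog (homog P) = P.
Proof.
case: P => [z|]; rewrite /dehomog /homog !mxE /= ?eqxx //.
by rewrite oner_eq0 divr1.
Qed.

Lemma homogK v : v != 0 -> exists2 k, k != 0 & homog (dehomog v) = k *: v.
Proof.
have i2 (i : 'I_2) : i = 0 \/ i = 1.
  by case: i => [[|[|//]] h]; [left|right]; apply/val_inj.
move=> v0; rewrite /dehomog; case: eqP => [v10|/eqP v10].
- have v00 : v 0 0 != 0.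
    apply: contra_neq v0 => v00; apply/matrixP => i j; rewrite !mxE (ord1 j).
    by case: (i2 i) => ->.
  exists (v 0 0)^-1; first by rewrite invr_eq0.
  apply/matrixP => i j; rewrite !mxE (ord1 j).
  by case: (i2 i) => -> /=; rewrite ?mulVf // v10 mulr0.
- exists (v 1 0)^-1; first by rewrite invr_eq0.
  apply/matrixP => i j; rewrite !mxE (ord1 j).
  by case: (i2 i) => -> /=; rewrite ?mulVf // mulrC.
Qed.

Lemma dehomogZ k v : k != 0 -> dehomog (k *: v) = dehomog v.
Proof.
move=> k0; rewrite /dehomog !mxE mulf_eq0 (negPf k0) /=; case: eqP => // _.
by rewrite -mulf_div divff // mul1r.
Qed.

Lemma mobius1 : mobius 1%:M = id.
Proof. by apply/funext => P; rewrite /mobius mul1mx dehomogK. Qed.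

Lemma mobiusM A B : B \in unitmx -> mobius A \o mobius B = mobius (A *m B).
Proof.
move=> uB; apply/funext => P; rewrite /mobius /=.
have nz : B *m homog P != 0.
  apply: contra_neq (homog_neq0 P) => h.
  by rewrite -(mulKmx uB (homog P)) h mulmx0.
by have [k k0 ->] := homogK nz; rewrite -scalemxAr dehomogZ // mulmxA.
Qed.

Lemma projective_id : projective id.
Proof. by exists 1%:M; rewrite ?unitmx1 ?mobius1. Qed.

Lemma projective_comp f g : projective f -> projective g -> projective (f \o g).
Proof.
move=> [A uA ->] [B uB ->]; exists (A *m B); last by rewrite mobiusM.
by rewrite unitmx_mul uA.
Qed.

Lemma projective_inv f : projective f ->
  exists g, [/\ projective g, cancel f g & cancel g f].
Proof.
move=> [A uA ->]; exists (mobius (invmx A)).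
have uV : invmx A \in unitmx by rewrite unitmx_inv.
split; first by exists (invmx A).
- by move=> P; rewrite -[LHS]/((_ \o _) P) mobiusM // mulVmx // mobius1.
- by move=> P; rewrite -[LHS]/((_ \o _) P) mobiusM // mulmxV // mobius1.
Qed.

Lemma swapping_involution_conj a b c f g h :
  projective g -> projective h -> cancel g h -> cancel h g ->
  swapping_involution a b c f ->
  swapping_involution (g a) (g b) (g c) (g \o f \o h).
Proof.
move=> pg ph gK hK [pf ff f1 fb [fa fc]]; split => /=.
- by apply: projective_comp ph; apply: projective_comp.
- by move=> P /=; rewrite gK ff hK.
- move=> e; apply: f1; apply/funext => P.
  by have := congr1 (fun u => u (g P)) e; rewrite /= gK => /(can_inj gK).
- by rewrite gK fb.
- by rewrite !gK fa fc.
Qed.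

Lemma swap_involutionE a b c f : swapping_involution a b c f ->
  (forall g, swapping_involution a b c g -> g = f) -> swap_involution a b c = f.
Proof.
by move=> Pf uf; apply: xget_unique => // g [Pg _]; apply: uf.
Qed.

Lemma swap_involution_conj a b c g P : projective g ->
  swap_involution (g a) (g b) (g c) (g P) = g (swap_involution a b c P).
Proof.
move=> pg; have [h [ph gK hK]] := projective_inv pg.
have [[f [Pf uf]]|nex] := pselect (exists f, swapping_involution a b c f /\
    forall g, swapping_involution a b c g -> g = f).
  rewrite (swap_involutionE Pf uf) (@swap_involutionE _ _ _ (g \o f \o h)).
  - by rewrite /= gK.
  - exact: swapping_involution_conj.
  move=> k Pk; have := swapping_involution_conj ph pg hK gK Pk.
  rewrite !gK => /uf <-; apply/funext => Q /=; by rewrite !hK.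
rewrite /swap_involution !xgetPN // => f [Pf uf]; apply: nex.
  by exists f.
exists (h \o f \o g); split.
  by have := swapping_involution_conj ph pg hK gK Pf; rewrite !gK.
move=> k Pk; have /uf <- := swapping_involution_conj pg ph gK hK Pk.
by apply/funext => Q /=; rewrite !gK.
Qed.

End ProjectiveLine.

Section Leapfrog.
Variables (R : realType) (n : nat).

Definition twisted (M : RP1 R -> RP1 R) (S : int -> RP1 R) :=
  forall i, S (i + n%:Z) = M (S i).

Definition same_monodromy (p : (int -> RP1 R) * (int -> RP1 R)) :=
  exists M, [/\ projective M, twisted M p.1 & twisted M p.2].

Definition leapfrog_space :=
  {p : (int -> RP1 R) * (int -> RP1 R) | `[< same_monodromy p >]}.

Definition Sprev (p : leapfrog_space) : int -> RP1 R := (val p).1.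
Definition Scur (p : leapfrog_space) : int -> RP1 R := (val p).2.

Definition Snext (p : leapfrog_space) : int -> RP1 R := fun i =>
  swap_involution (Scur p (i - 1)) (Scur p i) (Scur p (i + 1)) (Sprev p i).

Lemma leapfrog_subproof p : `[< same_monodromy (Scur p, Snext p) >].
Proof.
have /asboolP[M [pM t1 t2]] := valP p.
apply/asboolP; exists M; split => // i; rewrite /= /Snext.
rewrite (addrAC i n%:Z) (addrAC i n%:Z 1) /Scur /Sprev !t2 t1.
exact: swap_involution_conj.
Qed.

(* The leapfrog map, extended to degenerate pairs as in [swap_involution]. *)
Definition leapfrog (p : leapfrog_space) : leapfrog_space :=
  exist _ (Scur p, Snext p) (leapfrog_subproof p).

(* Diagonal action of PGL(2, R). *)
Definition pgl_equiv (p q : leapfrog_space) : bool :=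
  `[< exists2 g, projective g &
      Sprev q = g \o Sprev p /\ Scur q = g \o Scur p >].

Lemma pgl_equiv_refl : reflexive pgl_equiv.
Proof. by move=> p; apply/asboolP; exists id => //; apply: projective_id. Qed.

Lemma pgl_equiv_sym : symmetric pgl_equiv.
Proof.
suff imp p q : pgl_equiv p q -> pgl_equiv q p by move=> p q; apply/idP/idP => /imp.
move=> /asboolP[g pg [e1 e2]]; have [h [ph gK _]] := projective_inv pg.
apply/asboolP; exists h => //; rewrite e1 e2.
by split; apply/funext => i /=; rewrite gK.
Qed.

Lemma pgl_equiv_trans : transitive pgl_equiv.
Proof.
move=> q p r /asboolP[g pg [e1 e2]] /asboolP[h ph [e3 e4]].
apply/asboolP; exists (h \o g); first exact: projective_comp.
by rewrite e3 e4 e1 e2.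
Qed.

Canonical pgl_equiv_rel :=
  EquivRel pgl_equiv pgl_equiv_refl pgl_equiv_sym pgl_equiv_trans.

(* S_n / PGL(2, R) *)
Definition moduli : Type := {eq_quot pgl_equiv_rel}%qT.

Definition moduli_leapfrog (O : moduli) : moduli := \pi_moduli (leapfrog (repr O)).

(* Non-vanishing of the denominators of the leapfrog equations and of the
   coordinates x and y of a pair. Those of T2, where x_i + y_i is a ratio of
   such differences, and of the coordinates of the image are then nonzero. *)
Definition generic (p : leapfrog_space) := forall i : int,
  [/\ Scur p i <> Scur p (i + 1), Sprev p i <> Sprev p (i + 1),
      Sprev p i <> Scur p i, Sprev p i <> Scur p (i - 1)
    & Sprev p i <> Scur p (i + 1)].

Definition xcoord (p : leapfrog_space) : int -> R := fun i =>
  let T := Sprev p in let S := Scur p in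
  (pdiff (S (i + 1)) (T (i + 2)) * pdiff (T i) (T (i + 1))) /
  (pdiff (T i) (S (i + 1)) * pdiff (T (i + 1)) (T (i + 2))).

Definition ycoord (p : leapfrog_space) : int -> R := fun i =>
  let T := Sprev p in let S := Scur p in
  (pdiff (T (i + 1)) (S (i + 1)) * pdiff (T (i + 2)) (S (i + 2)) *
     pdiff (T i) (T (i + 1))) /
  (pdiff (T (i + 1)) (S (i + 2)) * pdiff (T i) (S (i + 1)) *
     pdiff (T (i + 1)) (T (i + 2))).

Definition coords (p : leapfrog_space) : (int -> R) * (int -> R) :=
  (xcoord p, ycoord p).

Definition moduli_coords (O : moduli) : (int -> R) * (int -> R) :=
  coords (repr O).

End Leapfrog.

(* Indices mod n become indices in Z: this is applied to n-periodic x and y. *)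
Definition T2 (R : realType) (xy : (int -> R) * (int -> R)) :
    (int -> R) * (int -> R) :=
  let: (x, y) := xy in
  (fun i => x (i - 1) * ((x i + y i) / (x (i - 1) + y (i - 1))),
   fun i => y i * ((x (i + 1) + y (i + 1)) / (x i + y i))).

(* Main.v *)
(* In the coordinate u = 1/(z - S_i) the involution becomes affine, namely
   u |-> u_{i+1} + u_{i-1} - u, which is the first equation of (i); the other
   two are the same polynomial identity divided by different factors. Cleared
   of denominators, that identity is homogeneous in the lifts of all points
   involved, hence holds at infinity as well. It expresses the ratios
   [S_i, S_i^+] / [S_{i-1}, S_i^+] and [S_i^+, S_{i+1}] / [S_{i-1}, S_i^+] of
   determinants of lifts through S^- and S, and these are the only
   combinations of S^+ in the coordinates of the image. Finally x_i + y_i is a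
   single ratio by a Pluecker relation, and T_2 follows by cancellation. *)
Require Import Defs.
From mathcomp Require Import all_boot all_order all_algebra generic_quotient.
From mathcomp Require Import boolp classical_sets reals ring lra.

Set Implicit Arguments.
Unset Strict Implicit.
Unset Printing Implicit Defensive.

Import Order.TTheory GRing.Theory Num.Theory.
Local Open Scope ring_scope.
Local Open Scope quotient_scope.

(** * Determinants of lifts, and the swapping involution expressed through them *)

Section Pdiff.
Variable R : realType.
Implicit Types (P Q a b c v w : RP1 R) (A : 'M[R]_2).

Lemma pdiff_homog P Q :
  pdiff P Q = homog P 0 0 * homog Q 1 0 - homog P 1 0 * homog Q 0 0.
Proof. by case: P => [z|]; case: Q => [w|]; rewrite /homog !mxE /=; ring. Qed.

Lemma pdiffN P Q : pdiff P Q = - pdiff Q P.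
Proof. by rewrite !pdiff_homog; ring. Qed.

Lemma pdiff_eq0 P Q : pdiff P Q = 0 <-> P = Q.
Proof.
case: P => [z|]; case: Q => [w|] //=; split=> //.
- by move/subr0_eq ->.
- by case=> ->; rewrite subrr.
- by move/eqP; rewrite oppr_eq0 oner_eq0.
- by move/eqP; rewrite oner_eq0.
Qed.

Lemma pdiff_neq0 P Q : P <> Q -> pdiff P Q != 0.
Proof. by move=> PQ; apply/eqP => /pdiff_eq0. Qed.

Lemma det_mx2 A : \det A = A 0 0 * A 1 1 - A 0 1 * A 1 0.
Proof.
rewrite (expand_det_row _ 0) !big_ord_recl big_ord0 /cofactor !det_mx11 !mxE.
rewrite /= expr0 expr1 addr0 mul1r mulN1r mulrN.
by congr (_ * A _ _ - A _ _ * A _ _); apply/val_inj.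
Qed.

Lemma mulmx2E A (u : 'cV[R]_2) i :
  (A *m u) i 0 = A i 0 * u 0 0 + A i 1 * u 1 0.
Proof.
rewrite mxE !big_ord_recl big_ord0 addr0.
by congr (_ + A i _ * u _ 0); apply/val_inj.
Qed.

(** The lift of an image is the matrix image of the lift up to a scalar; [k] collects these scalars
    and [d] is the determinant of the matrix. *)
Lemma pdiff_projective (g : RP1 R -> RP1 R) : projective g ->
  exists (d : R) (k : RP1 R -> R), [/\ d != 0, forall P, k P != 0 &
    forall P Q, pdiff (g P) (g Q) = d * k P * k Q * pdiff P Q].
Proof.
move=> [A uA ->].
have /choice[k kP] : forall P, exists k : R,
    k != 0 /\ homog (mobius A P) = k *: (A *m homog P).
  move=> P; have nz : A *m homog P != 0.
    apply: contra_neq (homog_neq0 P) => h.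
    by rewrite -(mulKmx uA (homog P)) h mulmx0.
  by have [x x0 xE] := homogK nz; exists x.
exists (\det A), k; split=> [|P|P Q]; first by rewrite -unitfE -unitmxE.
  by have [] := kP P.
rewrite !pdiff_homog (kP P).2 (kP Q).2 det_mx2.
by rewrite !(mxE scalemx_key) !mulmx2E; ring.
Qed.

Lemma projective_zero_infty a b : a <> b ->
  exists g : RP1 R -> RP1 R, [/\ projective g, g a = Some 0 & g b = None].
Proof.
move=> /pdiff_neq0; rewrite pdiff_homog => ab.
(* The rows are the linear forms [pdiff a _] and [pdiff _ b], which vanish on the lifts of [a] and
   [b]; the determinant is [- pdiff a b]. *)
pose A : 'M[R]_2 := \matrix_(i, j) if i == 0
  then (if j == 0 then - homog a 1 0 else homog a 0 0)
  else (if j == 0 then homog b 1 0 else - homog b 0 0).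
exists (mobius A); split.
- exists A => //; rewrite unitmxE unitfE det_mx2 !mxE /=.
  by apply: contra_neq ab => h; rewrite -[RHS]oppr0 -h; ring.
- rewrite /mobius /dehomog !mulmx2E !mxE /=.
  case: eqP => [h|_]; first by case/eqP: ab; rewrite -h; ring.
  by rewrite mulNr [X in _ + X]mulrC addNr mul0r.
- rewrite /mobius /dehomog !mulmx2E !mxE /=.
  by case: eqP => // [[]]; ring.
Qed.

Lemma mobius_Some A (z : R) : mobius A (Some z) =
  if A 1 0 * z + A 1 1 == 0 then None
  else Some ((A 0 0 * z + A 0 1) / (A 1 0 * z + A 1 1)).
Proof. by rewrite /mobius /dehomog !mulmx2E /homog !mxE /= !mulr1. Qed.

Lemma mobius_None A : mobius A None =
  if A 1 0 == 0 then None else Some (A 0 0 / A 1 0).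
Proof.
by rewrite /mobius /dehomog !mulmx2E /homog !mxE /= !mulr1 !mulr0 !addr0.
Qed.

(** Fixing infinity forces the form z |-> p z + c, and involutivity forces p ^+ 2 = 1; p = 1 would
    give c = 0, hence the identity, which is excluded. *)
Lemma swap_involution_infty (c : R) P :
  swap_involution (Some 0) None (Some c) P = omap (fun z => c - z) P.
Proof.
set f : RP1 R -> RP1 R := omap (fun z => c - z).
suff -> : swap_involution (Some 0) None (Some c) = f by [].
apply: swap_involutionE.
  pose A : 'M[R]_2 := \matrix_(i, j) if i == 0
    then (if j == 0 then - 1 else c) else (if j == 0 then 0 else 1).
  split=> //.
  - exists A.
      rewrite unitmxE unitfE det_mx2 !mxE /= mulr0 subr0 mulr1.
      by rewrite oppr_eq0 oner_eq0.
    apply/funext => -[z|]; rewrite ?mobius_None ?mobius_Some !mxE /= ?eqxx //.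
    by rewrite mul0r add0r oner_eq0 divr1; congr Some; ring.
  - by case=> [z|] //=; congr Some; ring.
  (* The finite fixed point is [c / 2], so the test point [c / 2 + 1] is moved. *)
  - move=> /(congr1 (fun h => h (Some (c / 2 + 1)))) [] /eqP.
    by rewrite -subr_eq0 => /eqP h; lra.
  - by split=> /=; congr Some; ring.
move=> g [[A uA gE] gg g1 gb [ga gc]].
move: gb ga; rewrite gE mobius_None !mobius_Some !mulr0 !add0r.
case: (A 1 0 =P 0) => // A10 _; case: (A 1 1 =P 0) => // /eqP A11 [cE].
set p := A 0 0 / A 1 1.
have gS z : g (Some z) = Some (p * z + c).
  rewrite gE mobius_Some A10 mul0r add0r (negPf A11) -cE /p; congr Some.
  by field.
have gN : g None = None by rewrite gE mobius_None A10 eqxx.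
have pc : p * c + c = 0.
  by move: gc; rewrite gS => -[].
(* Involutivity at the point 1 reads p ^+ 2 + p c + c = 1. *)
have : p ^+ 2 == 1.
  have [pE] : Some (p * (p * 1 + c) + c) = Some (1 : R) by rewrite -!gS gg.
  by apply/eqP; rewrite -pE -[LHS]addr0 -pc; ring.
rewrite sqrf_eq1 => /orP[|] /eqP pE.
  case: g1; apply/funext => -[z|] //; rewrite gS.
  by move: pc; rewrite pE => pc; congr Some; lra.
by rewrite -gE; apply/funext => -[z|] //; rewrite gS pE /=; congr Some; ring.
Qed.

(* Both sides transform by the same factor under PGL(2, R), so it suffices to
   take a = 0 and b = infinity, where the involution is z |-> c - z. *)
Lemma swap_involutionP a b c v P : a <> b -> c <> b ->
  swap_involution a b c v = P <->
  pdiff a P * pdiff c b * pdiff v b = pdiff P b * pdiff a b * pdiff v c.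
Proof.
move=> ab cb.
have [g [pg ga gb]] := projective_zero_infty ab.
have [h [_ gK _]] := projective_inv pg.
have [d [k [d0 k0 gE]]] := pdiff_projective pg.
have -> : (pdiff a P * pdiff c b * pdiff v b =
           pdiff P b * pdiff a b * pdiff v c) <->
    (pdiff (g a) (g P) * pdiff (g c) (g b) * pdiff (g v) (g b) =
     pdiff (g P) (g b) * pdiff (g a) (g b) * pdiff (g v) (g c)).
  rewrite !gE.
  set x := pdiff a P * _ * _; set y := pdiff P b * _ * _.
  pose m := d ^+ 3 * k a * k P * k c * k b ^+ 2 * k v.
  have m0 : m != 0 by rewrite !mulf_neq0 ?expf_neq0.
  set l := (X in _ <-> X = _); set r := (X in _ <-> _ = X).
  have -> : l = m * x by rewrite /l /m /x; ring.
  have -> : r = m * y by rewrite /r /m /y; ring.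
  by split=> [->|/(mulfI m0)].
have -> : swap_involution a b c v = P <->
    swap_involution (g a) (g b) (g c) (g v) = g P.
  by rewrite swap_involution_conj //; split=> [->|/(can_inj gK)].
case gcE : (g c) => [z|]; last by case: cb; apply: (can_inj gK); rewrite gb.
rewrite ga gb swap_involution_infty.
(* When exactly one of the two points is infinite, the relation equates 0 with a nonzero
   constant. *)
case: (g v) => [x|]; case: (g P) => [y|] /=; split=> //.
- by move=> [<-]; ring.
- by move=> h'; congr Some; lra.
- by move=> h'; clear -h'; exfalso; lra.
- by move=> h'; clear -h'; exfalso; lra.
- by move=> _; ring.
Qed.

(** * Ratios of determinants that contain the image point *)

Section SwapRatio.
Variables (a b c v : RP1 R).
Hypotheses (ab : a <> b) (cb : c <> b) (vc : v <> c).
Let w := swap_involution a b c v.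

Let wE : pdiff a w * pdiff c b * pdiff v b = pdiff w b * pdiff a b * pdiff v c.
Proof. exact/swap_involutionP. Qed.

(** If [w] were [a], the left side of [wE] would vanish while the right side is a product of nonzero
    factors. The ratios below divide by [pdiff a w]. *)
Lemma swap_involution_neq : a <> w.
Proof.
move=> aw; move: wE; rewrite -aw (pdiff_eq0 a a).2 // !mul0r => /esym/eqP.
by apply/negP; rewrite !mulf_neq0 ?pdiff_neq0.
Qed.

Lemma swap_involution_ratio_fix :
  pdiff b w / pdiff a w = pdiff b c * pdiff v b / (pdiff a b * pdiff v c).
Proof.
have aw := pdiff_neq0 swap_involution_neq.
have ab0 := pdiff_neq0 ab; have vc0 := pdiff_neq0 vc.
apply/eqP; rewrite eqr_div ?mulf_neq0 //; apply/eqP.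
rewrite (pdiffN b w) (pdiffN b c).
by apply: oppr_inj; transitivity (pdiff w b * pdiff a b * pdiff v c);
  [ring | rewrite -wE; ring].
Qed.

Lemma swap_involution_ratio_swap :
  pdiff w c / pdiff a w =
  pdiff b c ^+ 2 * pdiff a v / (pdiff a b ^+ 2 * pdiff v c).
Proof.
have aw := pdiff_neq0 swap_involution_neq.
have ab0 := pdiff_neq0 ab; have vc0 := pdiff_neq0 vc.
apply/eqP; rewrite eqr_div ?mulf_neq0 ?expf_neq0 //; apply/eqP.
(* Pluecker relations for [a], [b], [w], [c] and for [a], [b], [v], [c]; [wE] then matches their
   terms in [pdiff a c]. *)
have p1 : pdiff a b * pdiff w c = pdiff a w * pdiff b c + pdiff w b * pdiff a c.
  by rewrite !pdiff_homog; ring.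
have p2 : pdiff b c * pdiff a v = pdiff a b * pdiff v c - pdiff v b * pdiff a c.
  by rewrite !pdiff_homog; ring.
transitivity (pdiff a b * pdiff w c * pdiff a b * pdiff v c); first by ring.
rewrite p1; transitivity (pdiff b c * (pdiff b c * pdiff a v) * pdiff a w);
  last by ring.
rewrite p2; transitivity (pdiff a w * pdiff b c * pdiff a b * pdiff v c +
  pdiff w b * pdiff a b * pdiff v c * pdiff a c); first by ring.
by rewrite -wE (pdiffN c b); ring.
Qed.

End SwapRatio.

End Pdiff.

(** * The coordinates on orbits and their values after one leapfrog step *)

Section Coordinates.
Variables (R : realType) (n : nat).
Implicit Types p q : leapfrog_space R n.

(* Each point, as well as the determinant of the transformation, occurs in [x]
   and in [y] with total degree zero, so the scale factors of the lifts cancel. *)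
Lemma coords_projective p q (g : RP1 R -> RP1 R) i j : projective g ->
  (forall k, Sprev q (j + k) = g (Sprev p (i + k)) /\
             Scur q (j + k) = g (Scur p (i + k))) ->
  xcoord q j = xcoord p i /\ ycoord q j = ycoord p i.
Proof.
move=> pg e; have [d [k [d0 k0 gE]]] := pdiff_projective pg.
(* Bare indices become [j + 0] and [i + 0], so that [e] applies to every point. *)
rewrite /xcoord /ycoord -(addr0 j) -(addr0 i) -!(addrA _ 0) !add0r.
rewrite !(e _).1 !(e _).2 !gE.
set T0 := Sprev p (i + 0); set T1 := Sprev p (i + 1).
set T2' := Sprev p (i + 2); set S1 := Scur p (i + 1).
set S2 := Scur p (i + 2).
have cancel (m x y : R) : m != 0 -> (m * x) / (m * y) = x / y.
  by move=> m0; rewrite -mulf_div divff // mul1r.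
split.
- rewrite -[RHS](cancel (d ^+ 2 * k S1 * k T2' * k T0 * k T1));
    last by rewrite !mulf_neq0 ?expf_neq0.
  by congr (_ / _); ring.
- rewrite -[RHS](cancel (d ^+ 3 * k T1 ^+ 2 * k S1 * k T2' * k S2 * k T0));
    last by rewrite !mulf_neq0 ?expf_neq0.
  by congr (_ / _); ring.
Qed.

Lemma coords_pgl p q : pgl_equiv p q -> coords q = coords p.
Proof.
move=> /asboolP[g pg [e1 e2]]; rewrite /coords.
by congr (_, _); apply/funext => i;
  have [] // := @coords_projective p q g i i pg;
  move=> k; rewrite e1 e2.
Qed.

(** A shift by [n] acts as the monodromy, so this is projective invariance with [q := p] and the two
    indices [i + n] and [i]. *)
Lemma coords_periodic p i :
  xcoord p (i + n%:Z) = xcoord p i /\ ycoord p (i + n%:Z) = ycoord p i.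
Proof.
have /asboolP[M [pM t1 t2]] := valP p.
apply: (coords_projective pM) => k.
by rewrite (addrAC i) /Sprev /Scur t1 t2.
Qed.

Lemma leapfrog_pgl p q : pgl_equiv p q -> pgl_equiv (leapfrog p) (leapfrog q).
Proof.
move=> /asboolP[g pg [e1 e2]]; apply/asboolP; exists g => //; split=> //.
apply/funext => i; rewrite /Scur /= /Snext e1 e2 /=.
exact: swap_involution_conj.
Qed.

Lemma pgl_equiv_repr p : pgl_equiv p (repr (\pi_(moduli R n) p)).
Proof. by apply/eqmodP; rewrite reprK. Qed.

Lemma xcoordDycoord p i : generic p -> xcoord p i + ycoord p i =
  (pdiff (Sprev p i) (Sprev p (i + 1)) *
   pdiff (Scur p (i + 1)) (Scur p (i + 2))) /
  (pdiff (Sprev p i) (Scur p (i + 1)) *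
   pdiff (Sprev p (i + 1)) (Scur p (i + 2))).
Proof.
move=> gp; have [_ _ _ _ /pdiff_neq0 h1] := gp i.
have [_ /pdiff_neq0 h2 _ _ /pdiff_neq0] := gp (i + 1).
rewrite /xcoord /ycoord; rewrite -!addrA in h2 *.
set T0 := Sprev p i in h1 *; set T1 := Sprev p (i + 1) in h2 *.
set T2' := Sprev p (i + 2) in h2 *; set S1 := Scur p (i + 1) in h1 *.
set S2 := Scur p (i + 2) => h3.
have pl : pdiff S1 S2 * pdiff T1 T2' =
   pdiff S1 T2' * pdiff T1 S2 + pdiff T1 S1 * pdiff T2' S2.
  by rewrite !pdiff_homog; ring.
(* Once [pdiff S1 S2] is eliminated, the remaining determinants can be treated as independent
   variables. *)
have -> : pdiff S1 S2 = (pdiff S1 T2' * pdiff T1 S2 + pdiff T1 S1 * pdiff T2' S2)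
    / pdiff T1 T2' by rewrite -pl mulfK.
by field; rewrite h1 h2 h3.
Qed.

Lemma Scur_leapfrogS p i : Scur (leapfrog p) (i + 1) =
  swap_involution (Scur p i) (Scur p (i + 1)) (Scur p (i + 2)) (Sprev p (i + 1)).
Proof. by rewrite {1}/Scur /= /Snext addrK -addrA. Qed.

Lemma xcoord_leapfrog p i : generic p -> xcoord (leapfrog p) i =
  (pdiff (Scur p i) (Sprev p (i + 1)) * pdiff (Scur p (i + 1)) (Scur p (i + 2))) /
  (pdiff (Scur p i) (Scur p (i + 1)) * pdiff (Sprev p (i + 1)) (Scur p (i + 2))).
Proof.
move=> gp; have [s01 _ _ _ _] := gp i; have [s12 _ _ _ t1s] := gp (i + 1).
rewrite -addrA (_ : 1 + 1 = 2) // in s12 t1s.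
rewrite /xcoord [Sprev (leapfrog p)]/(Scur p) Scur_leapfrogS.
have r := swap_involution_ratio_swap s01 (nesym s12) t1s.
set w := swap_involution _ _ _ _ in r *.
move/pdiff_neq0: s01; move/pdiff_neq0: s12; move/pdiff_neq0: t1s => n1 n2 n3.
(* The image point [w] is confined to the first quotient, which [r] evaluates. *)
transitivity (pdiff w (Scur p (i + 2)) / pdiff (Scur p i) w *
  (pdiff (Scur p i) (Scur p (i + 1)) / pdiff (Scur p (i + 1)) (Scur p (i + 2)))).
  by rewrite !invfM; ring.
by rewrite r; field; rewrite n1 n2 n3.
Qed.

Lemma ycoord_leapfrog p i : generic p -> ycoord (leapfrog p) i =
  (pdiff (Sprev p (i + 1)) (Scur p (i + 1)) *
   pdiff (Sprev p (i + 2)) (Scur p (i + 2)) *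
   pdiff (Scur p (i + 2)) (Scur p (i + 3))) /
  (pdiff (Sprev p (i + 1)) (Scur p (i + 2)) *
   pdiff (Sprev p (i + 2)) (Scur p (i + 3)) *
   pdiff (Scur p (i + 1)) (Scur p (i + 2))).
Proof.
move=> gp; have [s01 _ _ _ _] := gp i; have [s12 _ _ _ t1s] := gp (i + 1).
have [s23 _ _ _ t2s] := gp (i + 2).
rewrite -addrA (_ : 1 + 1 = 2) // in s12 t1s.
rewrite -addrA (_ : 2 + 1 = 3) // in s23 t2s.
have e2 : Scur (leapfrog p) (i + 2) =
  swap_involution (Scur p (i + 1)) (Scur p (i + 2)) (Scur p (i + 3))
    (Sprev p (i + 2)).
  by have := Scur_leapfrogS p (i + 1); rewrite -!addrA.
rewrite /ycoord [Sprev (leapfrog p)]/(Scur p) Scur_leapfrogS e2.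
have r1 := swap_involution_ratio_fix s01 (nesym s12) t1s.
have r2 := swap_involution_ratio_fix s12 (nesym s23) t2s.
set w1 := swap_involution _ _ _ _ in r1 *.
set w2 := swap_involution _ _ _ _ in r2 *.
move/pdiff_neq0: s01; move/pdiff_neq0: s12.
move/pdiff_neq0: t1s; move/pdiff_neq0: t2s => n1 n2 n3 n4.
(* Each image point is confined to its own quotient, evaluated by [r1] or [r2]. *)
transitivity (pdiff (Scur p (i + 1)) w1 / pdiff (Scur p i) w1 *
  (pdiff (Scur p (i + 2)) w2 / pdiff (Scur p (i + 1)) w2) *
  (pdiff (Scur p i) (Scur p (i + 1)) / pdiff (Scur p (i + 1)) (Scur p (i + 2)))).
  by rewrite !invfM; ring.
by rewrite r1 r2; field; rewrite n1 n2 n3 n4.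
Qed.

(** With x + y factored, both sides are the same monomial in determinants; genericity at three
    consecutive indices keeps the denominators nonzero. *)
Lemma coords_leapfrog p : generic p -> coords (leapfrog p) = T2 (coords p).
Proof.
move=> gp; rewrite /coords /T2; congr (_, _); apply/funext => i.
- rewrite xcoord_leapfrog // !xcoordDycoord // /xcoord.
  rewrite (_ : i - 1 + 2 = i + 1) ?subrK; last by rewrite -addrA.
  move: (gp (i - 1)) (gp i) (gp (i + 1)).
  rewrite !subrK !addrK -!addrA (_ : 1 + 1 = 2) //.
  move=> [_ /pdiff_neq0 n2 _ _ /pdiff_neq0 n3].
  move=> [/pdiff_neq0 n4 /pdiff_neq0 n5 _ _ /pdiff_neq0 n6].
  move=> [_ _ _ _ /pdiff_neq0 n9].
  by field; rewrite n2 n3 n4 n5 n6 n9.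
- rewrite ycoord_leapfrog // !xcoordDycoord // /ycoord.
  move: (gp i) (gp (i + 1)) (gp (i + 2)).
  have i11 : i + 1 + 1 = i + 2 by rewrite -addrA.
  have i12 : i + 1 + 2 = i + 3 by rewrite -addrA.
  have i21 : i + 2 + 1 = i + 3 by rewrite -addrA.
  rewrite i11 i12 i21.
  move=> [_ /pdiff_neq0 n2 _ _ /pdiff_neq0 n3].
  move=> [/pdiff_neq0 n4 /pdiff_neq0 n5 _ _ /pdiff_neq0 n6].
  move=> [_ _ _ _ /pdiff_neq0 n9].
  by field; rewrite n2 n3 n4 n5 n6 n9.
Qed.

End Coordinates.

(** * Equivalence of the affine forms of the leapfrog equation *)

Section Equations.
Variables (F : fieldType) (a b c v w : F).
Hypotheses (ab : a - b != 0) (cb : c - b != 0) (vb : v - b != 0).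
Hypothesis wb : w - b != 0.

(* All forms of the leapfrog equation say that this polynomial vanishes. *)
Let D := (a - w) * (c - b) * (v - b) - (w - b) * (a - b) * (v - c).

Let eq_iffD (l r k : F) : k != 0 -> l - r = k * D -> l = r <-> D = 0.
Proof.
move=> k0 e; split=> [lr|d0].
  by apply: (mulfI k0); rewrite -e lr subrr mulr0.
by apply/subr0_eq; rewrite e d0 mulr0.
Qed.

Lemma leapfrog_harmonicP : 1 / (w - b) + 1 / (v - b) = 1 / (c - b) + 1 / (a - b)
  <-> (a - w) * (c - b) * (v - b) = (w - b) * (a - b) * (v - c).
Proof.
pose m := ((a - b) * (c - b) * (v - b) * (w - b))^-1.
rewrite (@eq_iffD _ _ m).
- by rewrite (@eq_iffD _ _ 1) ?oner_eq0 // mul1r.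
- by rewrite invr_eq0 !mulf_neq0.
- by rewrite /m /D; field; rewrite ab cb vb wb.
Qed.

(** One cross-ratio form suffices: the harmonic equation is symmetric in [a] and [c], and exchanging
    them gives the other form. *)
Lemma leapfrog_crossP : v - a != 0 ->
  1 / (w - b) + 1 / (v - b) = 1 / (c - b) + 1 / (a - b) <->
  ((w - c) * (b - v) * (b - a)) / ((w - b) * (c - b) * (v - a)) = - 1.
Proof.
move=> va; pose m := - ((w - b) * (c - b) * (v - a))^-1.
rewrite leapfrog_harmonicP (@eq_iffD _ _ 1) ?oner_eq0 ?mul1r //.
have m0 : m != 0 by rewrite oppr_eq0 invr_eq0 !mulf_neq0.
apply: iff_sym; apply: (eq_iffD m0).
by rewrite /m /D; field; rewrite wb cb va.
Qed.

End Equations.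

Theorem theorem5p12 (R : realType) (n : nat) (hn : (0 < n)%N) :
  (* (i) *)
  (forall (p : leapfrog_space R n) (sm s sp : int -> R),
     generic p ->
     (forall i, Sprev p i = Some (sm i)) ->
     (forall i, Scur p i = Some (s i)) ->
     (forall i, sp i != s i) ->
     Sprev (leapfrog p) = Scur p /\
     forall i : int,
       let E1 := 1 / (sp i - s i) + 1 / (sm i - s i) =
                 1 / (s (i + 1) - s i) + 1 / (s (i - 1) - s i) in
       let E2 := ((sp i - s (i + 1)) * (s i - sm i) * (s i - s (i - 1))) /
                 ((sp i - s i) * (s (i + 1) - s i) * (sm i - s (i - 1))) = - 1 in
       let E3 := ((sp i - s (i - 1)) * (s i - sm i) * (s (i + 1) - s i)) /
                 ((sp i - s i) * (s i - s (i - 1)) * (sm i - s (i + 1))) = - 1 in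
       [/\ Scur (leapfrog p) i = Some (sp i) <-> E1, E1 <-> E2 & E2 <-> E3])
  /\
  (* (ii) *)
  [/\ (* the induced map and the coordinates are well defined on orbits *)
      forall p : leapfrog_space R n,
        moduli_leapfrog (\pi_(moduli R n) p) = \pi_(moduli R n) (leapfrog p),
      forall p : leapfrog_space R n,
        moduli_coords (\pi_(moduli R n) p) = coords p,
      forall (O : moduli R n) (i : int),
        (moduli_coords O).1 (i + n%:Z) = (moduli_coords O).1 i /\
        (moduli_coords O).2 (i + n%:Z) = (moduli_coords O).2 i
    & forall p : leapfrog_space R n, generic p ->
        moduli_coords (moduli_leapfrog (\pi_(moduli R n) p)) =
        T2 (moduli_coords (\pi_(moduli R n) p))].
Proof.
split.
  move=> p sm s sp gp Tp Sp sps; split=> // i E1 E2 E3.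
  have [s01 _ vb va vc] := gp i; have [s10 _ _ _ _] := gp (i - 1).
  rewrite subrK in s10; rewrite !Tp !Sp in s01 s10 vb va vc.
  have /= cb := pdiff_neq0 (nesym s01); have /= ab := pdiff_neq0 s10.
  have /= vb0 := pdiff_neq0 vb; have /= va0 := pdiff_neq0 va.
  have /= vc0 := pdiff_neq0 vc; have wb : sp i - s i != 0 by rewrite subr_eq0.
  have E12 : E1 <-> E2 by apply: leapfrog_crossP.
  have E13 : E1 <-> E3.
    (* [E3] is [E2] with [s (i - 1)] and [s (i + 1)] exchanged, up to two signs that cancel. *)
    rewrite /E3 -(opprB (s i) (s (i + 1))) -(opprB (s (i - 1)) (s i)).
    rewrite !mulrN !mulNr invrN mulrN opprK /E1 [X in _ = X <-> _]addrC.
    exact: leapfrog_crossP.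
  split=> //; last by rewrite -E12.
  (* Cleared of denominators, [E1] is the [pdiff] relation characterising the involution, read at
     finite points. *)
  rewrite /E1 leapfrog_harmonicP // {1}/Scur /= /Snext !Sp Tp.
  by apply: swap_involutionP => //; apply: nesym.
have coords_pi q : moduli_coords (\pi_(moduli R n) q) = coords q.
  by apply: coords_pgl; apply: pgl_equiv_repr.
split=> //.
- move=> p; apply/eqmodP; rewrite /= pgl_equiv_sym; apply: leapfrog_pgl.
  exact: pgl_equiv_repr.
- by move=> O i; apply: coords_periodic.
(* Genericity is given for [p], not for the chosen representative of its orbit, so the formula is
   applied at [p] and carried over by invariance. *)
- move=> p gp; rewrite /moduli_leapfrog !coords_pi -coords_leapfrog //.
  by apply/coords_pgl/leapfrog_pgl; exact: pgl_equiv_repr.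
Qed.
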